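(* Let $X$ be a set with $|X|\ge 3$ and let $n\ge 2$ be an integer. (1) For every integer $m\ge 1$, every $G\in\mathcal{H}_m$ is associative. (2) If $G\in\mathcal{H}_{n-1}$, then its $n$-ary extension $F=G^{n-1}$ is in $\mathcal{F}^n_{n-1}\setminus\mathcal{F}^n_1$. (3) Conversely, for every $F\in\mathcal{F}^n_{n-1}\setminus\mathcal{F}^n_1$ we have $|E_F|\ge 3$, the reductions of $F$ are exactly the operations $G_e$ for $e\in E_F$, and these operations lie in $\mathcal{H}_{n-1}$.
   Context: Notation: $k\boldsymbol{\cdot} x$ stands for the $k$-tuple $x,\ldots,x$. An operation $F\colon X^n\to X$ is associative if $F(x_1,\ldots,x_{i-1},F(x_i,\ldots,x_{i+n-1}),x_{i+n},\ldots,x_{2n-1})=F(x_1,\ldots,x_i,F(x_{i+1},\ldots,x_{i+n}),x_{i+n+1},\ldots,x_{2n-1})$ for all $x_1,\ldots,x_{2n-1}\in X$ and $1\le i\le n-1$. For $k\in\{1,\ldots,n\}$, $\mathcal{F}^n_k$ is the class of associative operations $F\colon X^n\to X$ such that $F(x_1,\ldots,x_n)\in\{x_1,\ldots,x_n\}$ whenever at least $k$ of the components $x_1,\ldots,x_n$ are equal to each other. An operation is quasitrivial if $F(x_1,\ldots,x_n)\in\{x_1,\ldots,x_n\}$ for all arguments; so $\mathcal{F}^n_1$ is the class of quasitrivial associative $n$-ary operations. For a binary associative $G\colon X^2\to X$, define $G^1=G$ and $G^m(x_1,\ldots,x_{m+1})=G^{m-1}(x_1,\ldots,x_{m-1},G(x_m,x_{m+1}))$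 for $m\ge 2$. If $F=G^{n-1}$, then $F$ is the $n$-ary extension of $G$, and the associative binary operation $G$ is called a (binary) reduction of $F$. An element $e\in X$ is neutral for $F\colon X^n\to X$ if $F((k-1)\boldsymbol{\cdot} e,x,(n-k)\boldsymbol{\cdot} e)=x$ for all $x\in X$ and $k\in\{1,\ldots,n\}$; $E_F$ is the set of neutral elements of $F$. For $e\in E_F$, $G_e\colon X^2\to X$ is defined by $G_e(x,y)=F(x,(n-2)\boldsymbol{\cdot} e,y)$. An element $a$ is an annihilator for an operation $F$ if $F(x_1,\ldots,x_n)=a$ whenever $a\in\{x_1,\ldots,x_n\}$. For an integer $m\ge1$, $\mathcal{H}_m$ is the class of binary operations $G\colon X^2\to X$ for which there is a subset $Y\subseteq X$ with $|Y|\ge 3$ such that: (a) $(Y,G|_{Y^2})$ is an Abelian group whose exponent divides $m$ (the exponent is the smallest integer $r\ge 1$ such that the $r$-th power of every element is the neutral element); (b) $G|_{(X\setminus Y)^2}$ is an associative and quasitrivial operation on $X\setminus Y$; (c) any $x\in X\setminus Y$ is an annihilator for $G|_{(\{x\}\cup Y)^2}$. *)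

(* Defs.v *)
From mathcomp Require Import all_boot.
From mathcomp Require Import boolp classical_sets functions cardinality.

Set Implicit Arguments.
Unset Strict Implicit.
Unset Printing Implicit Defensive.

Local Open Scope classical_set_scope.
Local Open Scope card_scope.

Definition op (X : Type) (n : nat) := n.-tuple X -> X.

(* The n-tuple (x_0, ..., x_{i-1}, F(x_i, ..., x_{i+n-1}), x_{i+n}, ..., x_{2n-2}),
   for i < n; only the first 2n-1 terms of the sequence x are used. *)
Definition splice (X : Type) (n : nat) (F : op X n) (x : nat -> X) (i : nat) :
    n.-tuple X :=
  [tuple if j < i then x j
         else if val j == i then F [tuple x (i + k) | k < n]
         else x (j + n.-1) | j < n].

Definition nassociative (X : Type) (n : nat) (F : op X n) : Prop :=
  forall (x : nat -> X) (i : nat), i.+1 < n ->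
    F (splice F x i) = F (splice F x i.+1).

Definition eq_components (X : Type) (n : nat) (k : nat) (t : n.-tuple X) : Prop :=
  exists A : {set 'I_n}, k <= #|A| /\
    forall i j : 'I_n, i \in A -> j \in A -> tnth t i = tnth t j.

Definition Fclass (X : Type) (n : nat) (k : nat) : set (op X n) :=
  [set F | nassociative F /\
     forall t : n.-tuple X, eq_components k t -> exists i : 'I_n, F t = tnth t i].

Arguments Fclass {X} n k _.

(* op_pow G m is G^m, of arity m + 1; starting the recursion from the unary
   identity yields G^1 = G, see op_pow1. *)
Fixpoint op_pow (X : Type) (G : X -> X -> X) (m : nat) : op X m.+1 :=
  match m with
  | 0 => fun t => thead t
  | m'.+1 => fun t =>
      op_pow G [tuple if i < m' then tnth t (widen_ord (leqnSn _) i)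
                      else G (tnth t (inord m')) (tnth t (inord m'.+1)) | i < m'.+1]
  end.

Lemma op_pow1 (X : Type) (G : X -> X -> X) (x y : X) :
  op_pow G [tuple x; y] = G x y.
Proof.
by rewrite /= /thead tnth_mktuple /= !(tnth_nth x) !inordK.
Qed.

Definition nary_ext (X : Type) (n : nat) (hn : 1 < n) (G : X -> X -> X) : op X n :=
  fun t => op_pow G (tcast (esym (prednK (ltnW hn))) t).

Definition reduction (X : Type) (n : nat) (hn : 1 < n) (F : op X n)
    (G : X -> X -> X) : Prop :=
  associative G /\ F = nary_ext hn G.

Definition neutrals (X : Type) (n : nat) (F : op X n) : set X :=
  [set e | forall (x : X) (k : 'I_n), F [tuple if j == k then x else e | j < n] = x].

Definition Gop (X : Type) (n : nat) (F : op X n) (e : X) : X -> X -> X :=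
  fun x y => F [tuple if val i == 0 then x
                      else if val i == n.-1 then y else e | i < n].

Definition associative_on (X : Type) (S : set X) (G : X -> X -> X) : Prop :=
  forall x y z, S x -> S y -> S z -> G x (G y z) = G (G x y) z.

Definition quasitrivial_on (X : Type) (S : set X) (G : X -> X -> X) : Prop :=
  forall x y, S x -> S y -> G x y = x \/ G x y = y.

Definition annihilator_on (X : Type) (S : set X) (G : X -> X -> X) (a : X) : Prop :=
  S a /\ forall x y, S x -> S y -> x = a \/ y = a -> G x y = a.

Definition abelian_group_on (X : Type) (S : set X) (G : X -> X -> X) (e : X) : Prop :=
  [/\ forall x y, S x -> S y -> S (G x y),
      associative_on S G,
      forall x y, S x -> S y -> G x y = G y x,
      S e /\ forall x, S x -> G e x = x
    & forall x, S x -> exists2 y, S y & G y x = e].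

Definition power_trivial (X : Type) (S : set X) (G : X -> X -> X) (e : X)
    (r : nat) : Prop :=
  forall x, S x -> iter r (G x) e = e.

Definition is_exponent (X : Type) (S : set X) (G : X -> X -> X) (e : X)
    (r : nat) : Prop :=
  [/\ 0 < r, power_trivial S G e r
    & forall s, 0 < s -> power_trivial S G e s -> r <= s].

Definition Hclass (X : Type) (m : nat) : set (X -> X -> X) :=
  [set G | exists Y : set X,
     [/\ `I_3 #<= Y,
         exists e, abelian_group_on Y G e /\
           exists2 r, is_exponent Y G e r & r %| m,
         associative_on (~` Y) G /\ quasitrivial_on (~` Y) G
       & forall x, (~` Y) x -> annihilator_on (x |` Y) G x]].

Arguments Hclass {X} m _.

(* Main.v *)
Require Import Defs.
From mathcomp Require Import all_boot zify.
From mathcomp Require Import boolp classical_sets functions cardinality.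

(* For F in F^n_{n-1}, any two x <> y satisfy one of: xy = x^2, xy = y^2 (inside
   every word), or x^(n-1) and y^(n-1) both act as the identity on x and y. In the
   last case x is neutral for F. If the last case never occurs, every word of length
   n can be contracted to a constant word on one of its letters, so F is
   quasitrivial. Hence a non-quasitrivial F has a neutral element e and F is the n-ary
   extension of the monoid G_e. The condition on words x..xyx..x then says that the
   neutral elements of F form a central group killed by n-1, and that all other
   elements are idempotent, absorb this group, and multiply quasitrivially. A product
   involving a non-neutral letter equals one of its letters, so a word witnessing
   non-quasitriviality is made of neutral elements; it is not constant, and two
   distinct letters together with its value give three neutral elements. *)

Set Implicit Arguments.
Unset Strict Implicit.
Unset Printing Implicit Defensive.

Local Open Scope classical_set_scope.
Local Open Scope card_scope.

(** * Constant words and words with one deviating letter *)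

Lemma nth_nseq_cons (T : Type) (z x y : T) (a b j : nat) : j <= a + b ->
  nth z (nseq a x ++ y :: nseq b x) j = if j == a then y else x.
Proof.
move=> jab; rewrite nth_cat size_nseq nth_nseq.
case: ltngtP => [//|aj|->]; last by rewrite subnn.
by rewrite -(subnSK aj) /= nth_nseq ifT //; lia.
Qed.

Lemma rcons_nseq (T : Type) (m : nat) (x : T) : rcons (nseq m x) x = nseq m.+1 x.
Proof. by elim: m => //= m ->. Qed.

Lemma nseq_pred_rcons (T : Type) (m : nat) (x : T) :
  0 < m -> nseq m x = rcons (nseq m.-1 x) x.
Proof. by case: m => // m _; rewrite rcons_nseq. Qed.

(** * Words under an associative operation of arity [q + 1], and existence of a neutral element *)

Section NaryWords.
Variables (X : eqType) (x0 : X) (q : nat) (F : op X q.+1).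

(* Totalized evaluation of F on words: meaningful on words of length q + 1. *)
Definition weval (s : seq X) : X := F [tuple nth x0 s i | i < q.+1].

Lemma weval_tuple (t : q.+1.-tuple X) : weval t = F t.
Proof. by congr F; apply: eq_from_tnth => i; rewrite tnth_mktuple -tnth_nth. Qed.

Lemma neutralsE (e : X) : neutrals F e <->
  forall a b x, a + b = q -> weval (nseq a e ++ x :: nseq b e) = x.
Proof.
split=> [Fe a b x abq|Fe x k].
  have aq : a < q.+1 by lia.
  rewrite -[RHS](Fe x (Ordinal aq)); congr F.
  apply: eq_from_tnth => i; rewrite !tnth_mktuple nth_nseq_cons ?abq //.
  by rewrite -ltnS.
have kq : k + (q - k) = q by rewrite subnKC // -ltnS.
rewrite -[RHS](Fe k (q - k) x kq); congr F.
by apply: eq_from_tnth => i; rewrite !tnth_mktuple nth_nseq_cons ?kq // -ltnS.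
Qed.

Lemma GopE (e x y : X) : 0 < q -> Gop F e x y = weval (x :: nseq q.-1 e ++ [:: y]).
Proof.
move=> q0; congr F; apply: eq_from_tnth => -[i iq]; rewrite !tnth_mktuple /=.
case: i iq => //= i iq; rewrite nth_cat size_nseq nth_nseq.
have -> : (i.+1 == q) = (i == q.-1) by lia.
by case: ltngtP => [//|?|->]; [lia|rewrite subnn].
Qed.

Lemma Fclass_nearly_constant : Fclass q.+1 q F ->
  forall a b x y, a + b = q ->
    weval (nseq a x ++ y :: nseq b x) = x \/ weval (nseq a x ++ y :: nseq b x) = y.
Proof.
move=> [_ Fq] a b x y abq.
have aq : a < q.+1 by lia.
have tE (j : 'I_q.+1) : nth x0 (nseq a x ++ y :: nseq b x) j =
    if val j == a then y else x by rewrite nth_nseq_cons // abq -ltnS.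
have [|i] := Fq [tuple nth x0 (nseq a x ++ y :: nseq b x) i | i < q.+1].
  exists [set~ Ordinal aq]%SET; rewrite cardsC1 card_ord; split=> // i j.
  by rewrite !inE -!val_eqE !tnth_mktuple !tE /= => /negbTE -> /negbTE ->.
by rewrite tnth_mktuple tE -/(weval _) => ->; case: ifP; [right|left].
Qed.

(** At least [q] of the [q + 1] positions leave out at most one index [k], so a tuple with [q] equal
    components is a word [x..xyx..x]. *)
Lemma Fclass_nearly_constantV : nassociative F ->
  (forall a b x y, a + b = q ->
    weval (nseq a x ++ y :: nseq b x) \in [:: x; y]) -> Fclass q.+1 q F.
Proof.
move=> Fa Fq; split=> // t [A [qA At]].
have [k kP] : exists k : 'I_q.+1, forall i j : 'I_q.+1, i != k -> j != k ->
    tnth t i = tnth t j.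
  case: (pickP (mem (~: A)%SET)) => [k kA|A0]; last first.
    have inA i : i \in A by move: (A0 i); rewrite /= inE => /negbFE.
    by exists ord0 => i j _ _; apply: At.
  have kA' i : i != k -> i \in A.
    move=> ik; apply: contraT => iA.
    have : ([set i; k] \subset ~: A)%SET.
      by apply/fintype.subsetP => z /set2P[]->; rewrite // inE.
    by move/subset_leq_card; rewrite cards2 ik cardsCs finset.setCK card_ord; lia.
  by exists k => i j ik jk; apply: At; exact: kA'.
pose x := if [pick i | i != k] is Some i then tnth t i else tnth t k.
have tx i : i != k -> tnth t i = x.
  by rewrite /x; case: pickP => [j jk ik|/(_ i)->//]; exact: kP.
have [i0 xi0] : exists i, x = tnth t i.
  by rewrite /x; case: pickP => [j _|_]; eexists.
have kq : k + (q - k) = q by rewrite subnKC // -ltnS.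
have -> : F t = weval (nseq k x ++ tnth t k :: nseq (q - k) x).
  congr F; apply: eq_from_tnth => i; rewrite tnth_mktuple nth_nseq_cons ?kq -1?ltnS //.
  by case: eqVneq => [/val_inj->//|/tx].
by have := Fq k (q - k) x (tnth t k) kq; rewrite !inE => /orP[]/eqP->;
   [exists i0|exists k].
Qed.

Lemma Fclass1E : nassociative F ->
  Fclass q.+1 1 F <-> forall s, size s = q.+1 -> weval s \in s.
Proof.
move=> Fa; split=> [[_ F1] s sq|F1].
  have sz : size s == q.+1 by rewrite sq.
  pose t := Tuple sz.
  have [|i Fi] := F1 t; last by rewrite -[s]/(tval t) weval_tuple Fi mem_tnth.
  by exists [set ord0]%SET; rewrite cards1; split=> // i j /set1P-> /set1P->.
split=> // t _; have := F1 t (size_tuple t).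
by rewrite weval_tuple => /tnthP[i ->]; exists i.
Qed.

Hypothesis Fa : nassociative F.

(** Associativity moves the bracket one position at a time, so both sides equal the value with the
    bracket at the front of the same word of length [2q + 1]. *)
Lemma weval_assoc (u v w u' v' w' : seq X) :
  size v = q.+1 -> size v' = q.+1 -> size u + size w = q ->
  u ++ v ++ w = u' ++ v' ++ w' ->
  weval (u ++ weval v :: w) = weval (u' ++ weval v' :: w').
Proof.
have key u1 v1 w1 s : size v1 = q.+1 -> size u1 + size w1 = q ->
    s = u1 ++ v1 ++ w1 ->
    weval (u1 ++ weval v1 :: w1) = F (splice F (nth x0 s) (size u1)).
  move=> sv suw ->; congr F; apply: eq_from_tnth => j; rewrite !tnth_mktuple.
  rewrite nth_cat; case: ltngtP => [uj|uj|->]; first by rewrite nth_cat uj.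
    have -> : nth x0 (u1 ++ v1 ++ w1) (j + q) = nth x0 w1 (j - size u1).-1.
      by rewrite !nth_cat sv !ifN -?leqNgt; [congr nth| |]; lia.
    by rewrite -(subnSK uj) /=; congr nth; lia.
  rewrite subnn; congr F; apply: eq_from_tnth => k; rewrite !tnth_mktuple.
  by rewrite nth_cat ltnNge leq_addr addKn nth_cat sv ltn_ord.
have splice0 s i : i <= q -> F (splice F (nth x0 s) i) = F (splice F (nth x0 s) 0).
  by elim: i => // i IHi iq; rewrite -Fa ?IHi // ltnW.
move=> sv sv' suw E; have := congr1 size E; rewrite !size_cat sv sv' => sE.
rewrite (key u v w _ sv suw erefl) (key u' v' w' _ sv' _ E); last by lia.
by rewrite !splice0 //; lia.
Qed.

Lemma weval_shift (u m v : seq X) (x y : X) :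
  size m = q -> size u + size v = q.-1 -> 0 < q ->
  weval (u ++ weval (x :: m) :: y :: v) = weval (u ++ x :: weval (rcons m y) :: v).
Proof.
move=> sm suv q0; rewrite -[x :: weval _ :: v]cat1s catA.
apply: weval_assoc; rewrite /= ?size_rcons ?sm //; first by lia.
by rewrite -catA cat_rcons.
Qed.

Hypotheses (q0 : 0 < q) (Fq : forall a b x y, a + b = q ->
  weval (nseq a x ++ y :: nseq b x) = x \/ weval (nseq a x ++ y :: nseq b x) = y).

Lemma weval_nseq (x : X) : weval (nseq q.+1 x) = x.
Proof. by case: (Fq x x (add0n q)). Qed.

(* xy = z^2 in the enveloping semigroup. *)
Definition contracts (x y z : X) := forall u v : seq X,
  size u + size v = q.-1 -> weval (u ++ x :: y :: v) = weval (u ++ z :: z :: v).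

(** Each failing equation of the third case yields a contraction: [x^q y = x] gives
    [xy = x (x^q y) = x^2], and [x y^q = y] gives [xy = (x y^q) y = y^2]. With these excluded,
    [y x^q = x] gives [xy = y (x^q y) = y^2], and [y^q x = y] gives [xy = (x y^q) x = x^2]. *)
Lemma contracts_or_neutral (x y : X) :
  contracts x y x \/ contracts x y y \/
  [/\ weval (rcons (nseq q x) y) = y, weval (y :: nseq q x) = y,
      weval (rcons (nseq q y) x) = x & weval (x :: nseq q y) = x].
Proof.
have wx t : weval (t :: nseq q t) = t := weval_nseq t.
have wr t : weval (rcons (nseq q t) t) = t by rewrite rcons_nseq weval_nseq.
have szq t : size (nseq q t) = q := size_nseq q t.
have FqL s t : weval (rcons (nseq q s) t) = s \/ weval (rcons (nseq q s) t) = t.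
  by rewrite -cats1; apply: (Fq s t (addn0 q)).
have FqR s t : weval (t :: nseq q s) = s \/ weval (t :: nseq q s) = t.
  exact: (Fq s t (add0n q)).
have [xy|xy] := FqL x y.
  by left => u v uv; rewrite -{1}(wx x) weval_shift // xy.
have [yx|yx] := FqR y x.
  by right; left => u v uv; rewrite -{1}(wr y) -weval_shift // yx.
have [xy'|xy'] := FqR x y.
  by right; left => u v uv; rewrite -{1}xy' weval_shift // xy.
have [yx'|yx'] := FqL y x.
  by left => u v uv; rewrite -{1}yx' -weval_shift // yx.
by right; right.
Qed.

(* The hypotheses say that the idempotents x^(n-1) and y^(n-1) of the enveloping
   semigroup coincide; so x^(n-1) z lies in {x, z} and in {y, z}. *)
Lemma neutral_of_pair (x y : X) : x <> y ->
  weval (rcons (nseq q x) y) = y -> weval (y :: nseq q x) = y ->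
  weval (rcons (nseq q y) x) = x -> weval (x :: nseq q y) = x ->
  neutrals F x.
Proof.
move=> neq xy yx yx' xy'.
have szq (t : X) : size (nseq q t) = q := size_nseq q t.
have xz z : weval (rcons (nseq q x) z) = z.
  (* The product [x^q y^q z] equals [y^q z] since [x^q y = y], and [x^q z] since [x y^q = x]. *)
  set b := weval (rcons (nseq q y) z).
  have E1 : weval (nseq q x ++ b :: [::]) = b.
    rewrite /b (@weval_assoc _ _ _ [::] (rcons (nseq q x) y)
      (rcons (nseq q.-1 y) z)) ?size_rcons ?szq ?addn0 //= ?xy.
      by rewrite -rcons_cons -[y :: _]/(nseq q.-1.+1 y) prednK.
    by rewrite cats0 cat_rcons -rcons_cons -[y :: _]/(nseq q.-1.+1 y) prednK.
  have E2 : weval (nseq q x ++ b :: [::]) = weval (rcons (nseq q x) z).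
    rewrite /b (@weval_assoc _ _ _ (nseq q.-1 x) (x :: nseq q y) [:: z])
      ?size_rcons /= ?szq ?addn0 //= ?xy'.
      by rewrite [in RHS](nseq_pred_rcons x q0) -!cats1 -catA.
    by rewrite cats0 cats1 -cat_rcons rcons_nseq prednK.
  have := Fq x z (addn0 q); have := Fq y z (addn0 q).
  rewrite /= !cats1 -/b -E2 E1 => -[->|->] [|] //.
  by move=> yx0; case: neq.
have zx z : weval (z :: nseq q x) = z.
  set b := weval (z :: nseq q y).
  have E1 : weval (b :: nseq q x) = b.
    rewrite /b (@weval_assoc [::] _ _ (z :: nseq q.-1 y) (y :: nseq q x) [::])
      /= ?szq ?addn0 //= ?yx ?size_nseq ?prednK //.
      by rewrite cats1 rcons_nseq prednK.
    by rewrite cats0 -cat_rcons rcons_nseq prednK.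
  have E2 : weval (b :: nseq q x) = weval (z :: nseq q x).
    rewrite /b (@weval_assoc [::] _ _ [:: z] (rcons (nseq q y) x) (nseq q.-1 x))
      ?size_rcons /= ?szq ?addn0 //= ?yx'.
      by rewrite -[x :: _]/(nseq q.-1.+1 x) prednK.
    by rewrite cat_rcons -[x :: _]/(nseq q.-1.+1 x) prednK.
  have := Fq x z (add0n q); have := Fq y z (add0n q).
  rewrite /= -/b -E2 E1 => -[->|->] [|] //.
  by move=> yx0; case: neq.
apply/neutralsE => a b z abq.
(* If [x^a z x^b = x], multiplying by [x^b] on the left and [x^a] on the right gives
   [z = x^q z x^q = x^(q+1) = x]. *)
have [E|//] := Fq x z abq; rewrite E.
have : weval (nseq b x ++ weval (nseq a x ++ z :: nseq b x) :: nseq a x) =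
       weval (weval (rcons (nseq q x) z) :: nseq q x).
  apply: (@weval_assoc _ _ _ [::]); rewrite ?size_rcons ?size_cat /= ?size_nseq //; try lia.
  by rewrite cat_rcons !catA -nseqD -catA /= -nseqD addnC abq.
rewrite xz zx E -[x :: nseq a x]/(nseq a.+1 x) -nseqD addnS addnC abq.
by rewrite weval_nseq.
Qed.

(** The word is read from the left as a block of one letter [x] and a rest. If [xy = x^2], the next
    letter [y] joins the block; if [xy = y^2], the whole block turns into [y]. At the end a constant
    word remains. *)
Lemma quasitrivial_of_contracts :
  (forall x y, contracts x y x \/ contracts x y y) ->
  forall s, size s = q.+1 -> weval s \in s.
Proof.
move=> C s sq.
suff H v x k : k.+1 + size v = q.+1 -> weval (nseq k.+1 x ++ v) \in x :: v.
  by case: s sq => // x v sq; apply: (H v x 0).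
elim: v x k => [|y v IHv] x k kv.
  by move: kv; rewrite addn0 cats0 => ->; rewrite weval_nseq mem_head.
have [Cx|Cy] := C x y.
  have -> : weval (nseq k.+1 x ++ y :: v) = weval (nseq k.+2 x ++ v).
    by rewrite -rcons_nseq cat_rcons Cx ?size_nseq -?cat_rcons ?rcons_nseq //;
      move: kv => /=; lia.
  have := IHv x k.+1; rewrite !inE => H.
  by rewrite orbCA H ?orbT //; move: kv => /=; lia.
(* The copies of [x] become [y] one at a time from the right; [0 < m] keeps a [y] next to the last
   [x]. *)
suff Hj j m : j + m = k.+2 -> 0 < m ->
    weval (nseq j x ++ nseq m y ++ v) = weval (nseq k.+2 y ++ v).
  rewrite (Hj k.+1 1) ?addn1 // inE; apply/orP; right.
  by apply: IHv; move: kv => /=; lia.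
elim: j m => [|j IHj] [//|m] jm _; first by rewrite -jm.
rewrite -(IHj m.+2) //; last by lia.
rewrite -rcons_nseq cat_rcons /= Cy //.
by rewrite size_nseq size_cat size_nseq; move: kv => /=; lia.
Qed.

Lemma neutral_exists : ~ (forall s, size s = q.+1 -> weval s \in s) ->
  exists e, neutrals F e.
Proof.
move=> nq; apply: contrapT => nE; apply: nq.
apply: quasitrivial_of_contracts => x y.
have [->|neq] := pselect (x = y); first by left=> u v _.
have [|[|[xy yx yx' xy']]] := contracts_or_neutral x y; [by left|by right|].
by case: nE; exists x; apply: neutral_of_pair xy yx yx' xy'.
Qed.

End NaryWords.

(** * Sets with at least three elements *)

Lemma card_ge3P (T : Type) (A : set T) : `I_3 #<= A <->
  exists a b c, [/\ A a, A b & A c] /\ [/\ a <> b, a <> c & b <> c].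
Proof.
split=> [/card_leP[f]|[a [b [c [[Aa Ab Ac] [ab ac bc]]]]]].
  have finj (i j : `I_3) : set_val i != set_val j -> set_val (f i) <> set_val (f j).
    move=> ij fij; case/eqP: ij; congr set_val.
    by apply: (@inj _ _ _ f); rewrite ?in_setT //; apply: val_inj.
  have mI k : k < 3 -> k \in `I_3 by move=> k3; rewrite inE.
  pose i0 : `I_3 := SigSub (mI 0 isT); pose i1 : `I_3 := SigSub (mI 1 isT).
  pose i2 : `I_3 := SigSub (mI 2 isT).
  exists (set_val (f i0)), (set_val (f i1)), (set_val (f i2)).
  by split; split; try exact: set_valP; apply: finj.
have [f] : $| {injfun `I_3 >-> A} |.
  apply/injfunPex; exists (nth a [:: a; b; c]) => [|i j]; first by case=> [|[|[|]]].
  by rewrite !inE; case: i => [|[|[|//]]] _; case: j => [|[|[|//]]] _ //= E; congruence.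
exact: inj_card_le f.
Qed.

(** * Iterated products of a binary operation and its [n]-ary extension *)

Section Products.
Variables (X : Type) (x0 : X) (G : X -> X -> X).

(* The value x0 of the empty product is junk unless x0 is neutral for G. *)
Fixpoint sprod (s : seq X) : X :=
  if s is x :: s' then if s' is [::] then x else G x (sprod s') else x0.

Lemma sprod_cons2 (x y : X) (s : seq X) : sprod (x :: y :: s) = G x (sprod (y :: s)).
Proof. by []. Qed.

Lemma sprod_last2 (s : seq X) (x y : X) :
  sprod (s ++ [:: x; y]) = sprod (s ++ [:: G x y]).
Proof. by elim: s => [//|a [|b s] IHs] //; rewrite !cat_cons !sprod_cons2 -IHs. Qed.

(** Each recursive step of [op_pow] contracts the last two entries, which [sprod_last2] shows to be
    harmless for the right-nested product. *)
Lemma op_powE (m : nat) (t : m.+1.-tuple X) : op_pow G t = sprod t.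
Proof.
elim: m t => [|m IHm] t.
  by case: t => [[|x [|y s]] i] //; rewrite /= /thead (tnth_nth x0).
rewrite [LHS]IHm.
have st := size_tuple t.
transitivity (sprod (take m t ++ [:: G (nth x0 t m) (nth x0 t m.+1)])); last first.
  rewrite -sprod_last2 -[in RHS](cat_take_drop m t) (drop_nth x0) ?st //.
  by rewrite (drop_nth x0) ?st // drop_oversize ?st.
congr sprod; apply: (@eq_from_nth _ x0).
  by rewrite size_tuple size_cat size_take st ltnW //= addn1.
move=> i; rewrite size_tuple => im; rewrite -[i]/(val (Ordinal im)) nth_mktuple /=.
rewrite nth_cat size_take st (leqnSn m.+1) !(tnth_nth x0) !inordK //=.
case: ltnP => mi; first by rewrite nth_take.
by have -> : i = m by [lia]; rewrite subnn.
Qed.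

Lemma nary_extE (n : nat) (hn : 1 < n) (t : n.-tuple X) : nary_ext hn G t = sprod t.
Proof. by rewrite /nary_ext op_powE val_tcast. Qed.

Lemma sprod_cons (x : X) (s : seq X) : right_id x0 G -> sprod (x :: s) = G x (sprod s).
Proof. by case: s => //= ->. Qed.

Lemma sprod_nseq (k : nat) (x : X) : right_id x0 G ->
  sprod (nseq k x) = iter k (G x) x0.
Proof.
move=> G1; elim: k => // k IHk.
by rewrite -[nseq _ _]/(x :: nseq k x) sprod_cons // IHk.
Qed.

Hypothesis GA : associative G.

Lemma sprod_cat_unital (u v : seq X) : left_id x0 G -> right_id x0 G ->
  sprod (u ++ v) = G (sprod u) (sprod v).
Proof.
move=> G1l G1r; elim: u => [|x u IHu]; first by rewrite G1l.
by rewrite cat_cons !sprod_cons // IHu GA.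
Qed.

Lemma sprod_cat (u v : seq X) : u <> [::] -> v <> [::] ->
  sprod (u ++ v) = G (sprod u) (sprod v).
Proof.
elim: u => [//|a [|b u] IHu] _ v0; first by case: (v) v0.
by rewrite !cat_cons !sprod_cons2 -!cat_cons IHu // GA.
Qed.

Lemma sprod_splice (u v w : seq X) : v <> [::] ->
  sprod (u ++ sprod v :: w) = sprod (u ++ v ++ w).
Proof.
move=> v0; have step : sprod (sprod v :: w) = sprod (v ++ w).
  by case: w => [|a w]; rewrite ?cats0 // sprod_cat.
have vw0 : v ++ w <> [::] by case: (v) v0.
by case: u => [//|a u]; rewrite (sprod_cat _ vw0) // sprod_cat // step.
Qed.

(** By [sprod_splice] the inner bracket can be removed, so each of its positions gives the product
    of the same [2q + 1] letters. *)
Lemma nary_ext_assoc (q : nat) (hq : 1 < q.+1) : nassociative (nary_ext hq G).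
Proof.
have key (x : nat -> X) i : i <= q ->
    nary_ext hq G (splice (nary_ext hq G) x i) =
    sprod [seq x k | k <- iota 0 (q + q.+1)].
  move=> iq; rewrite nary_extE.
  have -> : q + q.+1 = i + (q.+1 + (q - i)) by lia.
  rewrite !iotaD !map_cat -sprod_splice //.
  congr sprod; apply: (@eq_from_nth _ x0).
    by rewrite size_tuple size_cat /= !size_map !size_iota; lia.
  move=> j; rewrite size_tuple => jq; rewrite -[j]/(val (Ordinal jq)) nth_mktuple.
  set c := sprod [seq x k | k <- _].
  rewrite nth_cat size_map size_iota /=; case: ltngtP => [ji|ij|->].
  - by rewrite (nth_map 0) ?size_iota // nth_iota.
  - by rewrite -(subnSK ij) /= (nth_map 0) ?size_iota ?nth_iota; [congr x| |]; lia.
  by rewrite subnn nary_extE /= /c -[0 + i]addn0 iotaDl -val_enum_ord -!map_comp.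
by move=> x i iq; rewrite !key // ltnW.
Qed.

End Products.

(** * Binary reductions and neutral elements *)

Section Reductions.
Variables (X : eqType) (q : nat) (hq : 1 < q.+1).
Let q0 : 0 < q := hq.

Lemma weval_nary_ext (x0 : X) (G : X -> X -> X) (s : seq X) : size s = q.+1 ->
  weval x0 (nary_ext hq G) s = sprod x0 G s.
Proof.
move=> sq; rewrite /weval (nary_extE x0); congr sprod.
apply: (@eq_from_nth _ x0) => [|i]; rewrite size_tuple ?sq // => iq.
by rewrite -[i]/(val (Ordinal iq)) nth_mktuple.
Qed.

Section NeutralReduction.
Variables (F : op X q.+1) (e : X).
Hypotheses (Fa : nassociative F) (Fe : neutrals F e).

Let W := weval e F.
Let We (a b : nat) (x : X) : a + b = q -> W (nseq a e ++ x :: nseq b e) = x.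
Proof. by apply: (neutralsE e F e).1. Qed.

(** Writing [y = e y e^(q-1)] and shifting the bracket gives [y e = e (y e^q) = e y]. *)
Lemma neutral_comm (u v : seq X) (y : X) : size u + size v = q.-1 ->
  W (u ++ e :: y :: v) = W (u ++ y :: e :: v).
Proof.
move=> uv; have Ey : W (e :: y :: nseq q.-1 e) = y.
  by apply: (We (a := 1)); rewrite add1n prednK.
have yE : W (y :: nseq q e) = y by apply: (We (a := 0)).
rewrite -{2}Ey [RHS]weval_shift ?rcons_cons ?rcons_nseq /= ?size_nseq ?prednK //.
by rewrite -[e :: nseq _ _]/(nseq q.-1.+1 e) prednK // -/W yE.
Qed.

Lemma Gop_adjacent (x y : X) : Gop F e x y = W (x :: y :: nseq q.-1 e).
Proof.
rewrite (GopE e) //.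
suff H k j : k + j = q.-1 -> W (x :: nseq k e ++ y :: nseq j e) = W (x :: y :: nseq q.-1 e).
  by rewrite -/W -[[:: y]]/(y :: nseq 0 e) H // addn0.
elim: k j => [|k IHk] j kj; first by rewrite -kj.
rewrite -(IHk j.+1); last by rewrite addnS -addSn.
rewrite -rcons_nseq cat_rcons -!cat_cons neutral_comm //.
by rewrite /= !size_nseq.
Qed.

(** As [G_e(x, y) = x y e^(q-1)], shifting the bracket gives [(x y e^(q-1)) e = x (y e^q) = x y].
    Two letters can thus be traded for their product and one [e] at constant length. *)
Lemma Gop_contract (u v : seq X) (x y : X) : size u + size v = q.-1 ->
  W (u ++ Gop F e x y :: e :: v) = W (u ++ x :: y :: v).
Proof.
move=> uv; rewrite Gop_adjacent [LHS]weval_shift /= ?size_nseq ?prednK //.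
by rewrite rcons_nseq prednK // -/W (We (a := 0)).
Qed.

Lemma Gop_assoc : associative (Gop F e).
Proof.
move=> x y z; rewrite !(GopE e) //.
apply: (@weval_assoc _ _ _ _ Fa (x :: nseq q.-1 e) _ [::] [::]).
- by rewrite /= size_cat size_nseq /=; lia.
- by rewrite /= size_cat size_nseq /=; lia.
- by rewrite /= size_nseq; lia.
by rewrite cats0 /= -!catA.
Qed.

Lemma Gop_reduction : reduction hq F (Gop F e).
Proof.
split; first exact: Gop_assoc.
apply: funext => t; rewrite -(weval_tuple e F t) (nary_extE e).
(* Each contraction of the last two letters of [l] lengthens the padding by one [e], until a single
   letter followed by [q] copies of [e] remains. *)
suff H l k : l <> [::] -> size l + k = q.+1 -> W (l ++ nseq k e) = sprod e (Gop F e) l.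
  have := H t 0; rewrite cats0 addn0 size_tuple; apply => //.
  by case: t => -[].
have [m] := ubnP (size l); elim: m => // m IHm in l k *.
case/lastP: l => [//|l b]; case/lastP: l => [|l a].
  by move=> _ _ [bk]; apply: (We (a := 0)).
rewrite -!cats1 -catA cat1s sprod_last2 !size_cat /= => lm _ lk.
rewrite -(IHm _ k.+1) ?size_cat /=; [|lia|by case: (l)|lia].
by rewrite -!catA /= Gop_contract // size_nseq; lia.
Qed.

(* Conversely, if F = G^(n-1) then the power f = e^(n-1) in (X, G) is neutral for G,
   hence for F, and G = G_f. *)
Lemma reduction_Gop (G : X -> X -> X) : reduction hq F G ->
  exists2 f, neutrals F f & Gop F f = G.
Proof.
move=> [GA FG].
have We' a b x : a + b = q -> sprod e G (nseq a e ++ x :: nseq b e) = x.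
  move=> abq; rewrite -weval_nary_ext; last by rewrite size_cat /= !size_nseq addnS abq.
  by rewrite -FG; apply: We.
pose f := sprod e G (nseq q e).
have nz : nseq q e <> [::] by case: (q) q0.
have fx x : G f x = x by rewrite -(sprod_cat e GA nz (v := [:: x])) // (We' q 0) ?addn0.
have xf x : G x f = x by rewrite -(sprod_cat e GA (u := [:: x]) _ nz) // (We' 0 q).
(* The default of the product changes from [e] to [f], the unit of [G], so that empty padding also
   has value [f]. *)
have fk k : sprod f G (nseq k f) = f by rewrite sprod_nseq // iter_fix ?fx.
have cat_f u v := @sprod_cat_unital _ f G GA u v fx xf.
exists f.
  apply/(neutralsE f) => a b x abq; rewrite FG weval_nary_ext; last first.
    by rewrite size_cat /= !size_nseq addnS abq.
  by rewrite cat_f fk fx -cat1s cat_f fk xf.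
apply/funext => x; apply/funext => y.
rewrite (GopE f) // FG weval_nary_ext; last by rewrite /= size_cat size_nseq addn1 prednK.
by rewrite -cat1s cat_f cat_f fk fx.
Qed.

End NeutralReduction.
End Reductions.

(** * Abelian groups with a quasitrivial absorbing tail, and the classes [Hclass m] *)

(** The bound [|Y| >= 3] and associativity on the tail are kept apart, and the exponent enters as
    [y^m = e]. In this form the conditions can be shown for the neutral elements of [F] before three
    of them are known. *)
Definition group_with_tail (X : Type) (G : X -> X -> X) (Y : set X) (e : X) (m : nat) :=
  [/\ abelian_group_on Y G e, power_trivial Y G e m,
      quasitrivial_on (~` Y) G & forall x, (~` Y) x -> annihilator_on (x |` Y) G x].

(** For the least positive [r] with [y^r = e] on [Y], the remainder [m %% r] has the same property,
    so it is zero by minimality. *)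
Lemma power_trivial_exponent (X : Type) (Y : set X) (G : X -> X -> X) (e : X) (m : nat) :
  0 < m -> power_trivial Y G e m -> exists2 r, is_exponent Y G e r & r %| m.
Proof.
move=> m0 Ym; pose P k := (0 < k) && `[< power_trivial Y G e k >].
have exP : exists k, P k by exists m; rewrite /P m0; apply/asboolP.
case: (ex_minnP exP) => r /andP[r0 /asboolP Yr] rmin.
have rmul k x : Y x -> iter (k * r) (G x) e = e.
  by move=> Yx; elim: k => // k IHk; rewrite mulSn iterD IHk; apply: Yr.
exists r; first by split=> // s s0 Ys; apply: rmin; rewrite /P s0; apply/asboolP.
apply: contraT; rewrite /dvdn -lt0n => mr0.
suff /rmin : P (m %% r) by rewrite leqNgt ltn_mod r0.
rewrite /P mr0; apply/asboolP => x Yx.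
by rewrite -[RHS](Ym x Yx) {2}(divn_eq m r) addnC iterD rmul.
Qed.

Lemma HclassP (X : Type) (m : nat) (G : X -> X -> X) : 0 < m ->
  Hclass m G <-> exists Y e, [/\ `I_3 #<= Y, group_with_tail G Y e m &
    associative_on (~` Y) G].
Proof.
move=> m0; split=> [[Y [Y3 [e [YG [r [r0 Yr _] rm]]] [GA Gq] Yan]]|].
  exists Y, e; split=> //; split=> // x Yx.
  case/dvdnP: rm => k ->; elim: k => // k IHk.
  by rewrite mulSn iterD IHk; apply: Yr.
move=> [Y [e [Y3 [YG Ym Yq Yan] YA]]]; exists Y; split=> //.
by exists e; split=> //; apply: power_trivial_exponent.
Qed.

Section GroupWithTail.
Variables (X : eqType) (G : X -> X -> X) (Y : set X) (e : X) (m : nat).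
Hypothesis HG : group_with_tail G Y e m.

Lemma tail_absorbs (x y : X) : ~ Y x -> Y y -> G x y = x /\ G y x = x.
Proof.
move=> Yx Yy; have [_ _ _ /(_ x Yx)[_ an]] := HG.
by split; apply: an => /=; auto.
Qed.

Lemma group_unit : Y e. Proof. by case: HG => -[_ _ _ []]. Qed.

Lemma left_unit (x : X) : G e x = x.
Proof.
have [Yx|Yx] := pselect (Y x); first by case: HG => -[_ _ _ [_ ->]].
by have [] := tail_absorbs Yx group_unit.
Qed.

Lemma right_unit (x : X) : G x e = x.
Proof.
have [Yx|Yx] := pselect (Y x); last by have [] := tail_absorbs Yx group_unit.
by case: HG => -[_ _ C [Ye E] _] _ _ _; rewrite C // E.
Qed.

Lemma sprod_group (s : seq X) : (forall z, z \in s -> Y z) -> Y (sprod e G s).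
Proof.
elim: s => [_|x s IHs Ys]; first exact: group_unit.
rewrite (sprod_cons _ _ right_unit); case: HG => -[YG _ _ _ _] _ _ _; apply: YG.
  by apply: Ys; rewrite mem_head.
by apply: IHs => z zs; apply: Ys; rewrite inE zs orbT.
Qed.

(** Tail letters absorb group letters and multiply quasitrivially among themselves, so one of them
    survives as the product. *)
Lemma sprod_tail (s : seq X) : (exists2 z, z \in s & ~ Y z) ->
  sprod e G s \in s /\ ~ Y (sprod e G s).
Proof.
elim: s => [[z]//|x s IHs] [z zs Yz]; rewrite (sprod_cons _ _ right_unit) inE.
have [sY|sY] := pselect (exists2 z, z \in s & ~ Y z).
  have [ps Yp] := IHs sY; have [Yx|Yx] := pselect (Y x).
    by have [_ ->] := tail_absorbs Yp Yx; rewrite ps orbT.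
  by case: HG => _ _ /(_ x _ Yx Yp)[]-> _; rewrite ?eqxx ?ps ?orbT.
have Ys : Y (sprod e G s).
  by apply: sprod_group => t ts; apply: contrapT => Yt; case: sY; exists t.
have Yx : ~ Y x.
  by move: zs; rewrite inE => /orP[/eqP<-//|zs]; case: sY; exists z.
by have [-> _] := tail_absorbs Yx Ys; rewrite eqxx.
Qed.

(** In a mixed product both bracketings reduce to the product of the tail factors; the all-group and
    all-tail cases are assumptions. *)
Lemma group_with_tail_assoc : associative_on (~` Y) G -> associative G.
Proof.
move=> TA x y z; have [[YG YA _ _ _] _ Tq _] := HG.
have TG s t : ~ Y s -> ~ Y t -> ~ Y (G s t) by move=> Ys Yt; case: (Tq s t Ys Yt) => ->.
have aL s t (Ys : ~ Y s) (Yt : Y t) := (tail_absorbs Ys Yt).1.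
have aR s t (Ys : ~ Y s) (Yt : Y t) := (tail_absorbs Ys Yt).2.
have [Yx|Yx] := pselect (Y x); have [Yy|Yy] := pselect (Y y);
  have [Yz|Yz] := pselect (Y z).
- exact: YA.
- by rewrite (aR z y) // (aR z x) // (aR z (G x y)) //; apply: YG.
- by rewrite (aL y z) // (aR y x) // (aL y z).
- by rewrite (aR y x) // (aR (G y z) x) //; apply: TG.
- by rewrite (aL x y) // (aL x z) // (aL x (G y z)) //; apply: YG.
- by rewrite (aR z y) // (aL x y).
- by rewrite (aL y z) // (aL (G x y) z) //; apply: TG.
- exact: TA.
Qed.

Hypothesis GA : associative G.

(** If a tail letter occurs, [sprod_tail] applies. Otherwise the product lies in an Abelian group,
    where [x^a y x^b = y x^m = y]. *)
Lemma sprod_nearly_constant (a b : nat) (x y : X) : 0 < m -> a + b = m ->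
  sprod e G (nseq a x ++ y :: nseq b x) \in [:: x; y].
Proof.
move=> m0 abm; set s := nseq a x ++ _.
have s_sub z : z \in s -> z \in [:: x; y].
  rewrite mem_cat !inE !mem_nseq => /or3P[/andP[_ ->]|->|/andP[_ ->]] //.
  by rewrite orbT.
have [sY|sY] := pselect (exists2 z, z \in s & ~ Y z).
  by have [/s_sub] := sprod_tail sY.
have Yy : Y y.
  by apply: contrapT => Yy; case: sY; exists y; rewrite // mem_cat mem_head orbT.
have Yx : Y x.
  apply: contrapT => Yx; case: sY; exists x => //.
  (* As [a + b = m > 0], the letter [x] does occur in [s]. *)
  rewrite mem_cat inE !mem_nseq eqxx !andbT; move: m0; rewrite -abm.
  by case: (a) => //= ->; rewrite orbT.
have cat_e u v := @sprod_cat_unital _ e G GA u v left_unit right_unit.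
have sE k := sprod_nseq k x right_unit.
have Yk k : Y (iter k (G x) e).
  by rewrite -sE; apply: sprod_group => z /nseqP[-> _].
have [[_ _ C _ _] Ym _ _] := HG.
suff -> : sprod e G s = y by rewrite !inE eqxx orbT.
rewrite /s cat_e (sprod_cons _ _ right_unit) !sE GA (C _ y) // -GA.
by rewrite -!sE -cat_e -nseqD abm sE Ym // right_unit.
Qed.

End GroupWithTail.

(** If the extension were quasitrivial, the words [x y e^(q-1)] would put [xy] in [{x, y, e}]. For
    distinct [u] and [v] in [Y], both different from [e], cancellation then gives [uv = e = u^2],
    hence [u = v]. *)
Lemma Hclass_nary_ext (X : eqType) (q : nat) (hq : 1 < q.+1) (G : X -> X -> X) :
  Hclass q G -> (Fclass q.+1 q `\` Fclass q.+1 1) (nary_ext hq G).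
Proof.
move=> /(HclassP _ hq)[Y [e [/card_ge3P Y3 HG TA]]].
have GA := group_with_tail_assoc HG TA.
have FA := nary_ext_assoc e GA hq.
have G1l := left_unit HG; have G1r := right_unit HG.
split.
  apply: (Fclass_nearly_constantV (x0 := e) FA) => a b x y abq.
  rewrite weval_nary_ext; last by rewrite size_cat /= !size_nseq addnS abq.
  exact: (sprod_nearly_constant HG GA x y hq abq).
move=> /(Fclass1E e FA) F1.
have [u [v [Yu Yv neq ue ve]]] : exists u v, [/\ Y u, Y v, u <> v, u <> e & v <> e].
  case: Y3 => a [b [c [[Ya Yb Yc] [ab ac bc]]]].
  have [ae|ae] := pselect (a = e); first by exists b, c; split=> //; congruence.
  have [be|be] := pselect (b = e); first by exists a, c; split=> //; congruence.
  by exists a, b.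
have [[_ YA C _ Yinv] _ _ _] := HG.
have canc x y z : Y z -> G x z = G y z -> x = y.
  move=> Yz xy; have [t Yt tz] := Yinv z Yz.
  by rewrite -[x]G1r -[y]G1r -tz (C t z) // !GA xy.
have F2 x y : G x y = x \/ G x y = y \/ G x y = e.
  have := F1 (x :: y :: nseq q.-1 e); rewrite weval_nary_ext /= ?size_nseq ?prednK //.
  move=> /(_ erefl); rewrite -[G x _]/(sprod e G (x :: y :: nseq q.-1 e)).
  rewrite !sprod_cons // sprod_nseq // iter_fix ?G1l // G1r !inE mem_nseq.
  by case/or3P => [/eqP|/eqP|/andP[_ /eqP]]; auto.
have uve : G u v = e.
  case: (F2 u v) => [uv|[uv|//]]; first by case: ve; apply: (canc _ _ u) => //;
    rewrite C // uv G1l.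
  by case: ue; apply: (canc _ _ v) => //; rewrite uv G1l.
have uue : G u u = e.
  by case: (F2 u u) => [uu|[uu|//]]; case: ue; apply: (canc _ _ u) => //; rewrite uu G1l.
by case: neq; apply: (canc _ _ u) => //; rewrite uue C.
Qed.

(** * The group of neutral elements of an operation in [Fclass q.+1 q] *)

Section NeutralGroup.
Variables (X : eqType) (q : nat) (hq : 1 < q.+1) (F : op X q.+1) (e : X).
Hypotheses (HF : Fclass q.+1 q F) (Fe : neutrals F e).

Let q0 : 0 < q := hq.
Let G := Gop F e.
Let Fa : nassociative F := HF.1.
Let GA : associative G := Gop_assoc hq e Fa.

Let wevalE (s : seq X) : size s = q.+1 -> weval e F s = sprod e G s.
Proof.
by move=> sq; rewrite -(weval_nary_ext hq) // -(Gop_reduction hq Fa Fe).2.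
Qed.

Let G1l : left_id e G.
Proof.
move=> x; rewrite [G e x](GopE e) // -cat_cons -[e :: _]/(nseq q.-1.+1 e) prednK //.
by apply: ((neutralsE e F e).1 Fe q 0); rewrite addn0.
Qed.

Let G1r : right_id e G.
Proof.
move=> x; rewrite [G x e](GopE e) // cats1 rcons_nseq prednK //.
exact: ((neutralsE e F e).1 Fe 0 q).
Qed.

Local Notation "x ^^ k" := (iter k (G x) e) (at level 30).

Let powD (x : X) (a b : nat) : x ^^ (a + b) = G (x ^^ a) (x ^^ b).
Proof. by rewrite -!sprod_nseq // nseqD sprod_cat_unital. Qed.

Let wE (a b : nat) (x y : X) : a + b = q ->
  weval e F (nseq a x ++ y :: nseq b x) = G (x ^^ a) (G y (x ^^ b)).
Proof.
move=> abq; rewrite wevalE; last by rewrite size_cat /= !size_nseq addnS abq.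
by rewrite sprod_cat_unital // sprod_cons // !sprod_nseq.
Qed.

Let powP (a b : nat) (x y : X) : a + b = q ->
  G (x ^^ a) (G y (x ^^ b)) = x \/ G (x ^^ a) (G y (x ^^ b)) = y.
Proof. by move=> abq; rewrite -wE //; apply: Fclass_nearly_constant. Qed.

Let powS (x : X) : G x (x ^^ q) = x.
Proof. by case: (powP x x (add0n q)); rewrite /= G1l. Qed.

(** The value of [F] at [y, ..., y, e] is [y^q], and it is [e] for neutral [y]. Conversely,
    [y^a x y^b] is [x] or [y], and the value [y] gives [x = y^b (y^a x y^b) y^a = y^(q+1) = y]. *)
Lemma neutral_pow (y : X) : neutrals F y <-> y ^^ q = e.
Proof.
split=> [/(neutralsE e F y)/(_ q 0 e (addn0 q))|yq].
  by rewrite wE ?addn0 //= !G1r.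
apply/(neutralsE e) => a b x abq; rewrite wE //.
have [E|//] := powP y x abq; rewrite E.
have : G (y ^^ b) (G (G (y ^^ a) (G x (y ^^ b))) (y ^^ a)) = x.
  by rewrite !GA -powD -!GA -powD [b + a]addnC abq yq G1l G1r.
rewrite E => <-; rewrite -[G y _]/(y ^^ a.+1) -powD addnS addnC abq.
by rewrite iterS powS.
Qed.

(** Neutrality in the second position says [y x y^(q-1) = x]; multiplying by [y] on the right gives
    [x y = y x y^q = y x]. *)
Lemma neutral_central (x y : X) : neutrals F y -> G y x = G x y.
Proof.
move=> Yy; have yq := (neutral_pow y).1 Yy.
have := (neutralsE e F y).1 Yy 1 q.-1 x; rewrite add1n prednK // => /(_ erefl).
rewrite wE ?add1n ?prednK //= G1r => {2}<-.
have -> : G (G y (G x (y ^^ q.-1))) y = G (G y x) (G (y ^^ q.-1) (y ^^ 1)).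
  by rewrite /= G1r !GA.
by rewrite -powD addn1 prednK // yq G1r.
Qed.

(** By [neutral_pow] the neutral elements are the solutions of [y^q = e], with inverses [y^(q-1)];
    centrality gives closure. If [x] is not neutral, [x^q] lies in [{x, e}], hence is [x], so
    [xy = x^q y] lies in [{x, y}] for every [y]. *)
Lemma neutrals_group_with_tail : group_with_tail G (neutrals F) e q.
Proof.
have YG x y : neutrals F x -> neutrals F y -> neutrals F (G x y).
  move=> Yx Yy; apply/neutral_pow.
  suff -> k : (G x y) ^^ k = G (x ^^ k) (y ^^ k).
    by rewrite (neutral_pow x).1 // (neutral_pow y).1.
  elim: k => [|k IHk]; first by rewrite G1l.
  rewrite !iterS IHk -!GA; congr G.
  by rewrite !GA (neutral_central _ Yy).
have Yk x k : neutrals F x -> neutrals F (x ^^ k).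
  by move=> Yx; elim: k => // k IHk; apply: YG.
have powN x : ~ neutrals F x -> x ^^ q = x.
  move=> Yx; have [] := powP x e (addn0 q); rewrite /= !G1r //.
  by move/neutral_pow.
have inv x : neutrals F x -> G x (x ^^ q.-1) = e.
  by move=> Yx; rewrite -iterS prednK //; apply/neutral_pow.
have powN' x y : ~ neutrals F x -> G x y = x \/ G x y = y.
  by move=> Yx; have := powP x y (addn0 q); rewrite /= G1r powN.
split.
- split=> //.
  + by move=> x y Yx _; apply: neutral_central.
  + by move=> x Yx; exists (x ^^ q.-1); [exact: Yk|rewrite -neutral_central ?inv].
- by move=> x Yx; apply/neutral_pow.
- by move=> x y Yx _; apply: powN'.
(* For neutral [y], the value [xy = y] would give [x = e] on cancelling [y]. *)
move=> x Yx; have xy y : neutrals F y -> G x y = x.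
  move=> Yy; have [//|xy] := powN' x y Yx; case: Yx.
  suff -> : x = e by [].
  by rewrite -[LHS]G1r -(inv y Yy) GA xy.
have xx : G x x = x by rewrite -{2}(powN x Yx) powS.
split=> [|s t]; first by left.
move=> [->|Ys] [->|Yt] //; first by move=> _; apply: xy.
  by move=> _; rewrite neutral_central ?xy.
by case=> E; [rewrite E xy // | rewrite E neutral_central ?xy].
Qed.

Lemma neutrals_ge3 : ~ Fclass q.+1 1 F -> `I_3 #<= neutrals F.
Proof.
move=> F1; have HG := neutrals_group_with_tail.
have [s [sq Fs]] : exists s, size s = q.+1 /\ sprod e G s \notin s.
  apply: contrapT => N; apply: F1; apply/(Fclass1E e Fa) => s sq.
  by rewrite wevalE //; apply: contrapT => sN; apply: N; exists s; split=> //; apply/negP.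
have Ys z : z \in s -> neutrals F z.
  move=> zs; apply: contrapT => Yz; move/negP: Fs; apply.
  by have [] : _ /\ _ := sprod_tail HG (ex_intro2 _ _ z zs Yz).
have Yc := sprod_group HG Ys.
case: s => [//|x s] in sq Fs Ys Yc *.
(* A constant word has its letter as value by [powS], so [s] contains a letter other than [x]. *)
have sN : ~~ all (pred1 x) s.
  apply: contra Fs => /all_pred1P ->; case: sq => ->.
  by rewrite -[x :: _]/(nseq q.+1 x) sprod_nseq // iterS powS mem_head.
case/allPn: sN => y ys /eqP yx; apply/card_ge3P.
exists x, y, (sprod e G (x :: s)); split; split=> //.
- by apply: Ys; rewrite mem_head.
- by apply: Ys; rewrite inE ys orbT.
- by move=> xy; case: yx.
- by move=> E; move: Fs; rewrite -E mem_head.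
- by move=> E; move: Fs; rewrite -E inE ys orbT.
Qed.

End NeutralGroup.

Theorem theorem1p6 (X : Type) (n : nat) (hX : `I_3 #<= [set: X]) (hn : 1 < n) :
  (forall (m : nat) (G : X -> X -> X), 1 <= m -> Hclass m G -> associative G) /\
  (forall G : X -> X -> X, Hclass n.-1 G ->
     (Fclass n n.-1 `\` Fclass n 1) (nary_ext hn G)) /\
  (forall F : op X n, (Fclass n n.-1 `\` Fclass n 1) F ->
     `I_3 #<= neutrals F /\
     [set G | reduction hn F G] = Gop F @` neutrals F /\
     (Gop F @` neutrals F) `<=` Hclass n.-1).
Proof.
have /card_ge3P[x0 _] := hX.
case: n hn => [//|q] hq; split=> [m G m0 /(HclassP _ m0)[Y [e [_ HG TA]]]|].
  (* The sections on words work over an [eqType]; [{classic X}] supplies one for an arbitrary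
     type. *)
  exact: (@group_with_tail_assoc {classic X} G Y e m HG TA).
split=> [G HG|F [HF F1]]; first exact: (@Hclass_nary_ext {classic X} q hq G HG).
have FA := HF.1.
have [e Fe] : exists e, neutrals F e.
  apply: (@neutral_exists {classic X} x0 q F FA hq).
    exact: (@Fclass_nearly_constant {classic X} x0 q F HF).
  by move=> F1'; apply: F1; apply/(@Fclass1E {classic X} x0 q F FA).
have N3 := @neutrals_ge3 {classic X} q hq F e HF Fe F1.
split=> //; split=> [|_ [f Ff <-]].
  apply/seteqP; split=> [G GF|_ [f Ff <-]].
    by have [f Ff <-] := @reduction_Gop {classic X} q hq F e Fe G GF; exists f.
  exact: (@Gop_reduction {classic X} q hq F f FA Ff).
(* Any neutral [f] can take the role of [e], so the group structure is available for each [G_f]. *)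
have HG := @neutrals_group_with_tail {classic X} q hq F f HF Ff.
apply/(HclassP _ hq); exists (neutrals F), f; split=> // x y z _ _ _.
exact: (@Gop_assoc {classic X} q hq F f FA).
Qed.
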